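(* There exists a Hausdorff locally convex-solid (real) vector lattice $X$ whose topological completion $\hat X$ contains a positive element that is not the (topological) limit of any decreasing sequence of upper elements of $\hat X$.
   Context: All vector lattices are real; $X_+$ denotes the positive cone. A locally solid vector lattice is a vector lattice with a linear topology having a base of neighborhoods of zero consisting of solid sets ($U$ is solid if $|x|\le |y|$, $y\in U$ imply $x\in U$); it is locally convex-solid if its topology is in addition locally convex (equivalently, it is generated by a family of lattice seminorms, i.e. seminorms $p$ with $|x|\le|y|\Rightarrow p(x)\le p(y)$). Topological completion: for a Hausdorff locally solid vector lattice $X$, its topological completion is the pair $(\hat X, J)$, unique up to isomorphism, where $\hat X$ is a complete (every Cauchy net converges) Hausdorff topological vector space and $J\colon X\to\hat X$ is a linear topological embedding with dense range; $\hat X$ is ordered by taking as positive cone the closure of $J(X_+)$, which makes $\hat X$ a Hausdorff locally solid vector lattice and $J$ a lattice homomorphism. An element $\hat x\in\hat X$ is called an upper element if there exists an increasing sequence $(x_n)\subseteq X_+$ such that $Jx_n$ converges to $\hat x$ in the topology of $\hat X$. *)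

(* Defs.v *)
From HB Require Import structures.
From mathcomp Require Import all_boot all_order all_algebra.
From mathcomp Require Import all_classical all_reals all_analysis.

Set Implicit Arguments.
Unset Strict Implicit.
Unset Printing Implicit Defensive.

Import Order.TTheory GRing.Theory Num.Theory.
Import numFieldNormedType.Exports.

Local Open Scope classical_set_scope.
Local Open Scope ring_scope.

(* An ordered vector space in which any two elements have a supremum (infima
   then exist too, by negation).  The supremum is not taken from
   [Order.Lattice]: Hierarchy Builder rejects the join of [Order.Lattice] and
   [GRing.Zmodule], since [Num.RealDomain] inherits from both. *)
HB.mixin Record POrderedZmodule_isVectorLattice (R : numDomainType) E
    & Num.POrderedZmodule E & GRing.Lmodule R E := {
  vl_join : E -> E -> E ;
  vl_leUx : forall x y z : E, (vl_join x y <= z) = (x <= z) && (y <= z) ;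
  vl_leD2r : forall z x y : E, x <= y -> x + z <= y + z ;
  vl_scale_ge0 : forall (a : R) (x : E), 0 <= a -> 0 <= x -> 0 <= a *: x
}.

#[short(type="vectorLatticeType")]
HB.structure Definition VectorLattice (R : numDomainType) :=
  {E of POrderedZmodule_isVectorLattice R E
      & Num.POrderedZmodule E & GRing.Lmodule R E}.

Definition vl_abs (R : numDomainType) (E : vectorLatticeType R) (x : E) : E :=
  vl_join x (- x).

Definition solid (R : numDomainType) (E : vectorLatticeType R) (U : set E) :=
  forall x y : E, vl_abs x <= vl_abs y -> U y -> U x.

HB.mixin Record VectorLattice_isLocallySolid (R : numDomainType) E
    & TopologicalLmodule R E & VectorLattice R E := {
  locally_solid : forall U : set E,
    nbhs 0 U -> exists V : set E, [/\ nbhs 0 V, solid V & V `<=` U]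
}.

#[short(type="locallySolidType")]
HB.structure Definition LocallySolid (R : numDomainType) :=
  {E of VectorLattice_isLocallySolid R E
      & TopologicalLmodule R E & VectorLattice R E}.

(* The uniformity carried by a [tvsType] is only required to induce the
   topology; nothing below refers to it. *)
#[short(type="locallyConvexSolidType")]
HB.structure Definition LocallyConvexSolid (R : numDomainType) :=
  {E of LocallySolid R E & Tvs R E}.

Section topological_completion.
Context {R : numDomainType}.

(* Cauchyness and completeness refer to the canonical (translation-invariant)
   uniformity of a topological vector space, hence not to [cauchy], which
   depends on a given uniform structure. *)
Definition tvs_cauchy (E : topologicalLmodType R) (F : set_system E) :=
  (fun xy : E * E => xy.1 - xy.2) @ (F, F) --> (0 : E).

Definition tvs_complete (E : topologicalLmodType R) :=
  forall F : set_system E, ProperFilter F -> tvs_cauchy F -> exists x : E, F --> x.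

Definition topological_embedding (S T : topologicalType) (f : S -> T) :=
  injective f /\
  forall A : set S, open A <-> exists2 B : set T, open B & A = f @^-1` B.

Definition topological_completion (X : locallySolidType R)
    (Xh : topologicalLmodType R) (J : {linear X -> Xh}) :=
  [/\ hausdorff_space Xh, tvs_complete Xh,
      topological_embedding J & dense (range J)].

Context {X : locallySolidType R} {Xh : topologicalLmodType R}.

(* The completion has no order of its own as a type: its order is the one
   whose positive cone is the closure of the image of the positive cone. *)
Definition completion_cone (J : {linear X -> Xh}) : set Xh :=
  closure (J @` [set x | 0 <= x]).

Definition completion_le (J : {linear X -> Xh}) (u v : Xh) : Prop :=
  completion_cone J (v - u).

Definition upper_element (J : {linear X -> Xh}) (u : Xh) : Prop :=
  exists x : nat -> X,
    [/\ forall n, 0 <= x n, nondecreasing_seq x & J \o x @ \oo --> u].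

End topological_completion.

(* Main.v *)
Require Import Defs.
From HB Require Import structures.
From mathcomp Require Import all_boot all_order all_algebra.
From mathcomp Require Import all_classical all_reals all_analysis.
From mathcomp Require Import ring.

Import Order.TTheory GRing.Theory Num.Theory.
Import numFieldNormedType.Exports.

Local Open Scope classical_set_scope.
Local Open Scope ring_scope.

(** Fix an uncountable set [I].  The vector lattice is the space of finitely
    supported functions [I -> R] with the pointwise order and the topology of
    pointwise convergence.  It is locally convex-solid, because the boxes
    (finitely many coordinates constrained to lie within [e] of those of a
    centre) are convex, and solid when centred at the origin; its completion is
    the full product [R^I], in which it is dense because a box sees only
    finitely many coordinates ([finsupp_completion]).

    A pointwise limit of a sequence of functions vanishes wherever all of its
    terms do, and a countable union of countable sets is countable, so having
    countable support survives sequential limits ([countable_support_lim]).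
    Upper elements are sequential limits of finitely supported functions, hence
    have countable support, and so have limits of sequences of upper elements.
    The constant function 1, which is positive in [R^I]
    ([cone_cst1]), has support [I], and is therefore no such limit.

    The index set is [nat -> bool], uncountable by Cantor's diagonal
    argument. *)

Set Implicit Arguments.
Unset Strict Implicit.
Unset Printing Implicit Defensive.

(** * The product topology on real functions *)

Lemma cvg_initialP (S : choiceType) (T : topologicalType) (f : S -> T)
    (F : set_system S) (s : S) : Filter F ->
  F --> (s : initial_topology f) <-> f @ F --> f s.
Proof.
move=> FF; split => [Fs|Ffs A].
  by apply: (cvg_comp _ _ Fs); exact: (@initial_continuous S T f).
move=> [_ [[B Bop <-] Bfs BA]]; apply: filterS BA _.
by apply: Ffs; exact: open_nbhs_nbhs.
Qed.

(** A separate name for the product, so that it can carry at once the product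
    topology and the vector space structure of the functions [I -> R]. *)
Definition ptwise (I : Type) (R : realType) : Type := {ptws I -> R^o}.

Section pointwise_topology.
Context (I : choiceType) (R : realType).
Local Notation E := (ptwise I R).

HB.instance Definition _ := Uniform.on E.
HB.instance Definition _ := GRing.Lmodule.copy E (I -> R^o).

Lemma cvg_ptwiseP (F : set_system E) (f : E) : Filter F ->
  F --> f <-> forall i, (fun g : E => g i : R^o) @ F --> (f i : R^o).
Proof.
move=> FF; split=> [/cvg_sup Ff i|Ff].
  by have /(@cvg_initialP _ _ (fun g : I -> R^o => g i)) := Ff i.
apply/cvg_sup => i; apply/(@cvg_initialP _ _ (fun g : I -> R^o => g i)).
exact: Ff.
Qed.

Lemma coord_continuous (i : I) : continuous (fun g : E => g i : R^o).
Proof.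
move=> f; have /(@cvg_ptwiseP (nbhs f)) : nbhs f --> f by exact: cvg_id.
exact.
Qed.

Lemma ptwise_continuous (T : topologicalType) (h : T -> E) :
  (forall i, continuous (fun t => h t i : R^o)) -> continuous h.
Proof.
move=> hc t; apply: (proj2 (@cvg_ptwiseP (h @ t) (h t) _)) => i.
exact: (hc i t).
Qed.

Lemma coord_comp_continuous (T : topologicalType) (h : T -> E) i t :
  {for t, continuous h} -> {for t, continuous (fun z => h z i : R^o)}.
Proof.
move=> ht; exact: (@continuous_comp T E R^o h (fun g => g i) t ht
  (@coord_continuous i (h t))).
Qed.

Let ptwise_add_continuous : continuous (fun z : E * E => z.1 + z.2).
Proof.
apply: ptwise_continuous => i z.
have z1i := @coord_comp_continuous _ (@fst E E) i z
  (@cvg_fst _ _ _ _ (nbhs_filter _)).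
have z2i := @coord_comp_continuous _ (@snd E E) i z
  (@cvg_snd _ _ _ _ (nbhs_filter _)).
exact (@cvgD R R^o (E * E)%type (nbhs z) _ _ _ _ _ z1i z2i).
Qed.

HB.instance Definition _ :=
  PreTopologicalNmodule_isTopologicalNmodule.Build E ptwise_add_continuous.

Let ptwise_scale_continuous : continuous (fun z : R^o * E => z.1 *: z.2).
Proof.
apply: ptwise_continuous => i z.
have z2i := @coord_comp_continuous _ (@snd R^o E) i z
  (@cvg_snd _ _ _ _ (nbhs_filter _)).
exact (@cvgZ R R^o (R^o * E)%type (nbhs z) _ _ _ _ _
  (@cvg_fst _ _ _ _ (nbhs_filter _)) z2i).
Qed.

HB.instance Definition _ :=
  TopologicalNmodule_isTopologicalLmodule.Build R E ptwise_scale_continuous.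

Lemma ptwise_hausdorff : hausdorff_space E.
Proof. by apply: hausdorff_product => i; exact: norm_hausdorff. Qed.

(** The coordinates of a Cauchy filter are Cauchy in [R], and their limits make
    up the limit of the filter. *)
Lemma ptwise_complete : tvs_complete E.
Proof.
move=> F FF Fc.
have cvgi i : cvg ((fun g : E => g i : R^o) @ F).
  apply: cauchy_cvg; apply/cauchy_ballP => e e0.
  have : nbhs (0 : E) ((fun g : E => g i : R^o) @^-1` ball (0 : R^o) e).
    exact: (@coord_continuous i 0 _ (nbhsx_ballx (0 : R^o) e e0)).
  move=> /Fc [[A B] /= [FA FB] AB].
  exists ((fun g : E => g i : R^o) @` A, (fun g : E => g i : R^o) @` B).
    split; [apply: filterS FA|apply: filterS FB] => g gAB; by exists g.
  move=> [_ _] /= [[f Af <-] [g Bg <-]].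
  by have := AB (f, g) (conj Af Bg); rewrite -!ball_normE /= sub0r normrN.
exists (fun i => lim ((fun g : E => g i : R^o) @ F)).
exact/cvg_ptwiseP.
Qed.

Definition box (s : seq I) (e : R) (f : E) : set E :=
  [set g | forall i, i \in s -> `|f i - g i| < e].

Lemma box_open s e f : open (box s e f).
Proof.
elim: s => [|i s IHs].
  rewrite (_ : box _ _ _ = setT); first exact: openT.
  by apply/seteqP; split => // g _ i; rewrite in_nil.
rewrite (_ : box _ _ _ =
    (fun g : E => g i : R^o) @^-1` (ball (f i : R^o) e) `&` box s e f).
  apply: openI => //; apply: open_comp; last exact: ball_open.
  by move=> g _; exact: coord_continuous.
rewrite -ball_normE; apply/seteqP; split => g /=.
  move=> gb; split=> [|j js]; first by apply: gb; rewrite mem_head.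
  by apply: gb; rewrite inE js orbT.
by move=> [gi gs] j; rewrite inE => /predU1P[->//|/gs].
Qed.

(** The boxes around [f] generate a filter that converges to [f] in every
    coordinate, hence in the product; convergence says precisely that each
    neighbourhood of [f] belongs to that filter. *)
Lemma nbhs_boxP (f : E) (U : set E) : nbhs f U ->
  exists s, exists2 e, 0 < e & box s e f `<=` U.
Proof.
pose D := [set se : seq I * R | 0 < se.2].
pose F := filter_from D (fun se => box se.1 se.2 f).
have FF : Filter F.
  apply: filter_from_filter; first by exists ([::], 1); rewrite /D /=.
  move=> [s e] [t d] /= e0 d0; exists (s ++ t, Num.min e d).
    by rewrite /D /= lt_min e0 d0.
  by move=> g gb; split=> i ii; (have := gb i);
    rewrite mem_cat ii ?orbT lt_min => /(_ isT) /andP[].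
have Ff : F --> f.
  apply/cvg_ptwiseP => i A /nbhs_ballP[e /= e0 eA].
  exists ([:: i], e) => // g gb; apply: eA; rewrite -ball_normE /=.
  by apply: gb; rewrite /= inE.
by move=> /Ff [[s e] /= e0 sU]; exists s, e.
Qed.

End pointwise_topology.

(** * The vector lattice of finitely supported functions *)

Section finitely_supported.
Context (I : choiceType) (R : realType).

Definition finsupp_pred : {pred I -> R^o} :=
  fun f => `[< finite_set [set i | f i != 0] >].

Lemma finsupp_submod_closed : subsemimod_closed finsupp_pred.
Proof.
split.
  split=> [|f g /asboolP f0 /asboolP g0]; apply/asboolP.
    rewrite (_ : mkset _ = set0) //.
    by apply/seteqP; split => // i /=; rewrite eqxx.
  apply: (@sub_finite_set _ _ ([set i | f i != 0] `|` [set i | g i != 0])).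
    move=> i /=; have [fi0|] := eqVneq (f i) 0; last by left.
    move=> fgi; right; apply: contraNN fgi => /eqP gi0.
    apply/eqP; rewrite [LHS]/(@GRing.add R (f i) (g i)) fi0 gi0.
    exact: (@addr0 R 0).
  by rewrite finite_setU.
move=> a f /asboolP f0; apply/asboolP; apply: sub_finite_set f0 => i /=.
apply: contraNN => /eqP fi0; apply/eqP.
by rewrite [LHS]/(@GRing.mul R a (f i)) fi0; exact: (@mulr0 R a).
Qed.

HB.instance Definition _ :=
  GRing.isSubmodClosed.Build R (I -> R^o) finsupp_pred finsupp_submod_closed.

Record finsupp := Finsupp {
  finsupp_val :> I -> R^o ; _ : finsupp_val \in finsupp_pred }.

HB.instance Definition _ := [isSub for finsupp_val].
HB.instance Definition _ := [Choice of finsupp by <:].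
HB.instance Definition _ := [SubChoice_isSubLmodule of finsupp by <:].

Lemma finsupp_finite (x : finsupp) : finite_set [set i | x i != 0].
Proof. by case: x => f /= /asboolP. Qed.

Lemma finsuppP (x y : finsupp) : (forall i, x i = y i) -> x = y.
Proof. by move=> xy; apply/val_inj/funext. Qed.

Definition finsupp_le (x y : finsupp) := `[< forall i, x i <= y i >].

Lemma finsupp_le_refl : reflexive finsupp_le.
Proof. by move=> x; apply/asboolP. Qed.

Lemma finsupp_le_anti : antisymmetric finsupp_le.
Proof.
move=> x y /andP[/asboolP xy /asboolP yx].
by apply: finsuppP => i; apply: le_anti; rewrite xy yx.
Qed.

Lemma finsupp_le_trans : transitive finsupp_le.
Proof.
move=> y x z /asboolP xy /asboolP yz.
by apply/asboolP => i; exact: le_trans (xy i) (yz i).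
Qed.

HB.instance Definition _ := Order.Le_isPOrder.Build ring_display finsupp
  finsupp_le_refl finsupp_le_anti finsupp_le_trans.

Lemma finsupp_leP (x y : finsupp) : reflect (forall i, x i <= y i) (x <= y).
Proof. exact: asboolP. Qed.

Lemma finsupp_max_subproof (x y : finsupp) :
  ((fun i => Num.max (x i) (y i)) : I -> R^o) \in finsupp_pred.
Proof.
apply/asboolP.
apply: (@sub_finite_set _ _ ([set i | x i != 0] `|` [set i | y i != 0])).
  move=> i /=; have [->|] := eqVneq (x i) 0; last by left.
  have [->|] := eqVneq (y i) 0; last by right.
  by rewrite maxxx eqxx.
by rewrite finite_setU; split; exact: finsupp_finite.
Qed.

Definition finsupp_max (x y : finsupp) := Finsupp (finsupp_max_subproof x y).

Lemma finsupp_leUx (x y z : finsupp) :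
  (finsupp_max x y <= z) = (x <= z) && (y <= z).
Proof.
apply/finsupp_leP/andP => [xyz|[/finsupp_leP xz /finsupp_leP yz] i].
  by split; apply/finsupp_leP => i; have := xyz i; rewrite ge_max => /andP[].
by rewrite ge_max xz yz.
Qed.

Lemma finsupp_leD2r (z x y : finsupp) : x <= y -> x + z <= y + z.
Proof.
move=> /finsupp_leP xy; apply/finsupp_leP => i.
exact (lerD (xy i) (lexx (z i))).
Qed.

Lemma finsupp_scale_ge0 (a : R) (x : finsupp) : 0 <= a -> 0 <= x -> 0 <= a *: x.
Proof.
move=> a0 /finsupp_leP x0; apply/finsupp_leP => i.
exact (mulr_ge0 a0 (x0 i)).
Qed.

HB.instance Definition _ := POrderedZmodule_isVectorLattice.Build R finsupp
  finsupp_leUx finsupp_leD2r finsupp_scale_ge0.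

HB.instance Definition _ :=
  Uniform.copy finsupp (initial_topology (finsupp_val : finsupp -> ptwise I R)).

(** The embedding into the completion; its codomain is the topologized copy of
    the function space, unlike that of [finsupp_val]. *)
Definition to_ptwise (x : finsupp) : ptwise I R := finsupp_val x.

Lemma to_ptwise_continuous : continuous to_ptwise.
Proof. exact: initial_continuous. Qed.

Lemma finsupp_continuous (T : topologicalType) (h : T -> finsupp) :
  (forall i, continuous (fun t => h t i : R^o)) -> continuous h.
Proof.
move=> hc; apply: (@continuous_comp_initial _ _ _ to_ptwise).
exact: ptwise_continuous.
Qed.

Lemma finsupp_coord_continuous (T : topologicalType) (h : T -> finsupp) i t :
  {for t, continuous h} -> {for t, continuous (fun z => h z i : R^o)}.
Proof.
move=> ht; apply: (@coord_comp_continuous I R T (to_ptwise \o h) i t).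
exact: (@continuous_comp T finsupp (ptwise I R) h to_ptwise t ht
  (@to_ptwise_continuous (h t))).
Qed.

Let finsupp_add_continuous : continuous (fun z : finsupp * finsupp => z.1 + z.2).
Proof.
apply: finsupp_continuous => i z.
have z1i := @finsupp_coord_continuous _ (@fst finsupp finsupp) i z
  (@cvg_fst _ _ _ _ (nbhs_filter _)).
have z2i := @finsupp_coord_continuous _ (@snd finsupp finsupp) i z
  (@cvg_snd _ _ _ _ (nbhs_filter _)).
exact (@cvgD R R^o (finsupp * finsupp)%type (nbhs z) _ _ _ _ _ z1i z2i).
Qed.

HB.instance Definition _ := PreTopologicalNmodule_isTopologicalNmodule.Build
  finsupp finsupp_add_continuous.

Let finsupp_scale_continuous : continuous (fun z : R^o * finsupp => z.1 *: z.2).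
Proof.
apply: finsupp_continuous => i z.
have z2i := @finsupp_coord_continuous _ (@snd R^o finsupp) i z
  (@cvg_snd _ _ _ _ (nbhs_filter _)).
exact (@cvgZ R R^o (R^o * finsupp)%type (nbhs z) _ _ _ _ _
  (@cvg_fst _ _ _ _ (nbhs_filter _)) z2i).
Qed.

HB.instance Definition _ := TopologicalNmodule_isTopologicalLmodule.Build
  R finsupp finsupp_scale_continuous.

Lemma nbhs_finsuppP (x : finsupp) (U : set finsupp) : nbhs x U ->
  exists s, exists2 e, 0 < e & to_ptwise @^-1` box s e (to_ptwise x) `<=` U.
Proof.
move=> [_ [[B oB <-] Bx BU]].
have [s [e e0 sB]] := nbhs_boxP (open_nbhs_nbhs (conj oB Bx)).
by exists s, e => // y /sB; exact: BU.
Qed.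

Lemma box_nbhs (x : finsupp) s e : 0 < e ->
  nbhs x (to_ptwise @^-1` box s e (to_ptwise x)).
Proof.
move=> e0; apply: to_ptwise_continuous; apply: open_nbhs_nbhs; split.
  exact: box_open.
by move=> i _; rewrite subrr normr0.
Qed.

Lemma box_convex s e f : convex_set (to_ptwise @^-1` box s e f).
Proof.
apply/convex_setW => x y; rewrite !inE => xb yb k k0 k1.
rewrite inE => i si.
have -> : to_ptwise (conv k (x : convex_lmodType finsupp) y) i =
    k%:num * x i + (1 - k%:num) * y i :> R by [].
have -> : f i - (k%:num * x i + (1 - k%:num) * y i) =
    k%:num * (f i - x i) + (1 - k%:num) * (f i - y i) :> R by ring.
have k1' : 0 < 1 - k%:num :> R by rewrite subr_gt0.
rewrite (le_lt_trans (ler_normD _ _))// !normrM (gtr0_norm k0) (gtr0_norm k1').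
rewrite (_ : e = k%:num * e + (1 - k%:num) * e); last by ring.
by rewrite ltrD// ltr_pM2l//; [exact: xb|exact: yb].
Qed.

Lemma finsupp_locally_convex : exists2 B : set_system finsupp,
  (forall b, b \in B -> convex_set b) & basis B.
Proof.
exists [set b | exists s e f, b = to_ptwise @^-1` box s e f].
  by move=> _ /set_mem[s [e [f ->]]]; exact: box_convex.
split=> [_ [s [e [f ->]]]|x U /nbhs_finsuppP[s [e e0 sU]]].
  apply: open_comp; last exact: box_open.
  by move=> y _; exact: to_ptwise_continuous.
exists (to_ptwise @^-1` box s e (to_ptwise x)) => //; split.
  by exists s, e, (to_ptwise x).
by move=> i _; rewrite subrr normr0.
Qed.

HB.instance Definition _ := Uniform_isTvs.Build R finsupp finsupp_locally_convex.

Lemma finsupp_absE (x : finsupp) i : vl_abs x i = `|x i|.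
Proof. exact: (@maxrN R (x i)). Qed.

(** A box centred at the origin constrains only absolute values of coordinates,
    so it is solid. *)
Lemma finsupp_locally_solid (U : set finsupp) : nbhs 0 U ->
  exists V : set finsupp, [/\ nbhs 0 V, solid V & V `<=` U].
Proof.
move=> /nbhs_finsuppP[s [e e0 sU]].
exists (to_ptwise @^-1` box s e (to_ptwise 0)); split => //.
  exact: box_nbhs.
move=> x y /finsupp_leP xy yb i si.
have := xy i; rewrite !finsupp_absE => xyi.
have := yb i si; rewrite ![_ 0 i - _]sub0r !normrN.
exact: le_lt_trans.
Qed.

HB.instance Definition _ :=
  VectorLattice_isLocallySolid.Build R finsupp finsupp_locally_solid.

Lemma to_ptwise_is_linear : linear to_ptwise.
Proof. by []. Qed.

HB.instance Definition _ := GRing.isLinear.Build R finsupp (ptwise I R) _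
  to_ptwise to_ptwise_is_linear.

Lemma finsupp_hausdorff : hausdorff_space finsupp.
Proof.
move=> x y xy; apply: val_inj.
apply: (@ptwise_hausdorff I R) => A B Ax By.
have [z [zA zB]] := xy _ _ (@to_ptwise_continuous x _ Ax)
  (@to_ptwise_continuous y _ By).
by exists (to_ptwise z).
Qed.

Lemma finsupp_restr_subproof (s : seq I) (f : ptwise I R) :
  ((fun i => if i \in s then f i else 0) : I -> R^o) \in finsupp_pred.
Proof.
apply/asboolP; apply: sub_finite_set (finite_seq s) => i /=.
by case: ifP => //; rewrite eqxx.
Qed.

Definition finsupp_restr s f := Finsupp (finsupp_restr_subproof s f).

(** A function [f] agrees with its restriction to [s], extended by zero, on the
    coordinates constrained by a box over [s]. *)
Lemma to_ptwise_dense : dense (range to_ptwise).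
Proof.
move=> O [f Of] oO.
have [s [e e0 sO]] := nbhs_boxP (open_nbhs_nbhs (conj oO Of)).
exists (to_ptwise (finsupp_restr s f)); split; last by exists (finsupp_restr s f).
by apply: sO => i si; rewrite /= /to_ptwise /= si subrr normr0.
Qed.

(** The topology of [finsupp] is by definition the one induced by [to_ptwise],
    so an open set is exactly a preimage of an open set of [R^I]. *)
Lemma finsupp_completion : topological_completion to_ptwise.
Proof.
split; [exact: ptwise_hausdorff|exact: ptwise_complete| |exact: to_ptwise_dense].
split=> [x y|A]; first exact: val_inj.
by split=> [[B oB <-]|[B oB ->]]; exists B.
Qed.

(** * Countable supports and the counterexample *)

Definition countable_support (f : ptwise I R) := countable [set i | f i != 0].

(** Outside the union of the supports of the terms, every coordinate sequence
    is constantly zero. *)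
Lemma countable_support_lim (u : nat -> ptwise I R) (f : ptwise I R) :
  (forall n, countable_support (u n)) -> u @ \oo --> f -> countable_support f.
Proof.
move=> uc uf.
apply: (@sub_countable _ _ _ (\bigcup_n [set i | u n i != 0])); last first.
  by apply: bigcup_countable => // n _; exact: uc.
apply: subset_card_le => i /=; apply: contra_neqP => ui0.
have un0 n : u n i = 0.
  by apply/eqP; apply: contra_notT ui0 => uni; exists n.
have /cvg_ptwiseP/(_ i) := uf.
have -> : (fun g : ptwise I R => g i : R^o) @ (u @ \oo) = cst 0 @ \oo.
  by congr (_ @ \oo); apply/funext => n /=; rewrite un0.
by move=> ufi; apply: (cvg_unique _ ufi); [exact: norm_hausdorff|exact: cvg_cst].
Qed.

Lemma upper_countable_support (u : ptwise I R) :
  upper_element to_ptwise u -> countable_support u.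
Proof.
move=> [x [_ _ xu]]; apply: countable_support_lim xu => n.
by apply: finite_set_countable; exact: finsupp_finite.
Qed.

(** Each box around 1 contains the indicator function of its finite set of
    constrained coordinates. *)
Lemma cone_cst1 : completion_cone to_ptwise (fun=> 1).
Proof.
move=> A /nbhs_boxP[s [e e0 sA]].
exists (to_ptwise (finsupp_restr s (fun=> 1))); split.
  exists (finsupp_restr s (fun=> 1)) => //=; apply/finsupp_leP => i /=.
  by case: ifP => _; [exact: ler01|exact: lexx].
by apply: sA => i si; rewrite /= /to_ptwise /= si subrr normr0.
Qed.

End finitely_supported.

Lemma uncountable_bool_seq : ~ countable [set: nat -> bool].
Proof.
rewrite /countable => /pfcard_geP[/seteqP[T0 _]|[f]].
  exact: (T0 (fun=> true)).
have [n _ /(congr1 (@^~ n))] := @surj _ _ _ _ f (fun n => ~~ f n n) Logic.I.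
by rewrite /=; case: (f n n).
Qed.

Theorem theorem4p4 (R : realType) :
  exists (X : locallyConvexSolidType R) (Xh : topologicalLmodType R)
         (J : {linear X -> Xh}),
    [/\ hausdorff_space X,
        topological_completion J
      & exists2 x : Xh, completion_cone J x
          & ~ exists u : nat -> Xh,
              [/\ forall n, upper_element J (u n),
                  forall n, completion_le J (u n.+1) (u n)
                & u @ \oo --> x]].
Proof.
pose I : choiceType := (nat -> bool).
exists (finsupp I R), (ptwise I R), (@to_ptwise I R); split.
- exact: finsupp_hausdorff.
- exact: finsupp_completion.
exists (fun=> 1); first exact: cone_cst1.
move=> [u [uu _ u1]].
apply: uncountable_bool_seq.
have := countable_support_lim (fun n => upper_countable_support (uu n)) u1.
apply: sub_countable; apply: subset_card_le => i _ /=.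
exact: oner_neq0.
Qed.
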